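(* In the squared tensor-train setting described in the context, for a coefficient tensor $\mathsf B_k\in\mathbb R^{r_{k-1}\times n_k\times r_k}$ say that $\mathsf B_k$ defines the marginal function $\hat\pi_{\le k}$ if $$\hat\pi_{\le k}(x_{\le k})=\gamma\prod_{i=k+1}^d\lambda_i(\mathcal X_i)+\sum_{\ell_k=1}^{r_k}\Big(\sum_{\alpha_{k-1}=1}^{r_{k-1}}\mathsf G_{<k}^{(\alpha_{k-1})}(x_{<k})\,\mathsf P_k^{(\alpha_{k-1},\ell_k)}(x_k)\Big)^2,\qquad \mathsf P_k^{(\alpha_{k-1},\ell_k)}(x_k)=\sum_{i=1}^{n_k}\phi_k^{(i)}(x_k)\,\mathsf B_k[\alpha_{k-1},i,\ell_k].\qquad(\ast)$$ Then: (a) For $k=d$, $\mathsf B_d=\mathsf A_d$ defines $\hat\pi_{\le d}=\hat\pi$. (b) Suppose that for some $k>1$ the tensor $\mathsf B_k\in\mathbb R^{r_{k-1}\times n_k\times r_k}$ defines $\hat\pi_{\le k}$ as in $(\ast)$. Construct $\mathsf B_{k-1}\in\mathbb R^{r_{k-2}\times n_{k-1}\times r_{k-1}}$ as follows. (1) With the Cholesky decomposition $\mathsf L_k\mathsf L_k^\top=\mathsf M_k$ of the mass matrix, set $\mathsf C_k[\alpha_{k-1},\tau,\ell_k]=\sum_{i=1}^{n_k}\mathsf B_k[\alpha_{k-1},i,\ell_k]\,\mathsf L_k[i,\tau]$. (2) Unfold $\mathsf C_k$ along the first coordinate to a matrix $\mathsf C_k^{(\rm R)}\in\mathbb R^{r_{k-1}\times(n_kr_k)}$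 and compute the thin QR decomposition $\mathsf Q_k\mathsf R_k=(\mathsf C_k^{(\rm R)})^\top$, where $\mathsf Q_k\in\mathbb R^{(n_kr_k)\times r_{k-1}}$ has orthonormal columns and $\mathsf R_k\in\mathbb R^{r_{k-1}\times r_{k-1}}$ is upper triangular. (3) Set $$\mathsf B_{k-1}[\alpha_{k-2},i,\ell_{k-1}]=\sum_{\alpha_{k-1}=1}^{r_{k-1}}\mathsf A_{k-1}[\alpha_{k-2},i,\alpha_{k-1}]\,\mathsf R_k[\ell_{k-1},\alpha_{k-1}].$$ Then $\mathsf B_{k-1}$ defines the next marginal function $\hat\pi_{<k}=\hat\pi_{\le k-1}$, i.e. $(\ast)$ holds with $k$ replaced by $k-1$. (c) At $k=1$, with $\mathsf B_1$ the tensor obtained by this recursion and $\mathsf C_1$ formed from it as in (1), $\mathsf C_1^{(\rm R)}\in\mathbb R^{1\times(n_1r_1)}$ is a row vector, the thin QR decomposition $\mathsf Q_1\mathsf R_1=(\mathsf C_1^{(\rm R)})^\top$ produces a scalar $\mathsf R_1$ with $\mathsf R_1^2=\|\mathsf C_1^{(\rm R)}\|^2$, and the normalising constant $\hat z=\int_{\mathcal X_1}\hat\pi_{\le1}(x_1)\lambda_1(x_1)\,dx_1$ equals $$\hat z=\gamma\prod_{i=1}^d\lambda_i(\mathcal X_i)+\mathsf R_1^2 .$$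
   Context: $\mathcal X=\mathcal X_1\times\cdots\times\mathcal X_d$, $\mathcal X_k\subseteq\mathbb R$; $\lambda(x)=\prod_i\lambda_i(x_i)$ is a nonnegative measurable product weight with finite $\lambda_i(\mathcal X_i)=\int_{\mathcal X_i}\lambda_i$. Notation: $x_{\le k}=(x_1,\ldots,x_k)$, $x_{<k}=(x_1,\ldots,x_{k-1})$, $x_{>k}=(x_{k+1},\ldots,x_d)$. For each $k$, $\{\phi_k^{(i)}\}_{i=1}^{n_k}$ are real basis functions on $\mathcal X_k$, linearly independent and square-integrable with respect to $\lambda_k$. The mass matrix $\mathsf M_k\in\mathbb R^{n_k\times n_k}$ is $\mathsf M_k[i,j]=\int_{\mathcal X_k}\phi_k^{(i)}\phi_k^{(j)}\lambda_k\,dx_k$ (symmetric positive definite). Tensor train: $\tilde g(x)=\mathsf G_1(x_1)\cdots\mathsf G_d(x_d)$ with $\mathsf G_k:\mathcal X_k\to\mathbb R^{r_{k-1}\times r_k}$, $r_0=r_d=1$, and entries $\mathsf G_k^{(\alpha_{k-1},\alpha_k)}(x_k)=\sum_{i=1}^{n_k}\phi_k^{(i)}(x_k)\mathsf A_k[\alpha_{k-1},i,\alpha_k]$ for coefficient tensors $\mathsf A_k\in\mathbb R^{r_{k-1}\times n_k\times r_k}$; the ranks satisfy $r_{k-1}\le n_kr_k$ so that the thin QR factors have the stated sizes. $\mathsf G_{<k}^{(\alpha_{k-1})}(x_{<k})$ is the $\alpha_{k-1}$-th entry of the row vector $\mathsf G_1(x_1)\cdots\mathsf G_{k-1}(x_{k-1})$,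 with $\mathsf G_{<1}=1$. $\gamma>0$ is a constant, $\hat\pi(x)=\gamma+\tilde g(x)^2$, and the marginal functions are $\hat\pi_{\le k}(x_{\le k})=\int\hat\pi(x_{\le k},x_{>k})\prod_{i=k+1}^d\lambda_i(x_i)\,dx_{>k}$ for $1\le k<d$, $\hat\pi_{\le d}=\hat\pi$, $\hat\pi_{<k}=\hat\pi_{\le k-1}$. Empty products equal $1$. Unfolding along the first coordinate: $\mathsf C_k^{(\rm R)}[\alpha,\,\tau+(\ell-1)n_k]=\mathsf C_k[\alpha,\tau,\ell]$. *)

(* Defs.v *)
From HB Require Import structures.
From mathcomp Require Import all_boot all_order all_algebra.
From mathcomp Require Import all_classical all_reals all_analysis.

Set Implicit Arguments.
Unset Strict Implicit.
Unset Printing Implicit Defensive.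

Import Order.TTheory GRing.Theory Num.Theory.
Import numFieldNormedType.Exports.

Local Open Scope classical_set_scope.
Local Open Scope ring_scope.

Section lebesgue_tuple.
Variable R : realType.

Definition cons_pair n (z : measurableTypeR R * n.-tuple (measurableTypeR R)) :
  n.+1.-tuple (measurableTypeR R) := [the n.+1.-tuple _ of z.1 :: z.2].

Lemma measurable_cons_pair n : measurable_fun setT (@cons_pair n).
Proof. exact: measurable_cons. Qed.

Section step.
Variables (n : nat)
  (mu : {sigma_finite_measure set (n.-tuple (measurableTypeR R)) -> \bar R}).

Definition leb_step : set (n.+1.-tuple (measurableTypeR R)) -> \bar R :=
  pushforward (lebesgue_measure \x mu)%E (@cons_pair n).

Let leb_step0 : leb_step set0 = 0%E.
Proof. by rewrite /leb_step /pushforward preimage_set0 measure0. Qed.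

Let leb_step_ge0 A : (0 <= leb_step A)%E.
Proof. by rewrite /leb_step /pushforward; exact: measure_ge0. Qed.

Let leb_step_sigma_additive : semi_sigma_additive leb_step.
Proof.
move=> F mF tF mUF; rewrite /leb_step /pushforward preimage_bigcup.
apply: measure_semi_sigma_additive.
- by move=> i; rewrite -[X in measurable X]setTI; exact: measurable_cons_pair.
- apply/trivIsetP => /= i j _ _ ij; rewrite -preimage_setI.
  by move/trivIsetP : tF => /(_ _ _ _ _ ij) ->//; rewrite preimage_set0.
- by rewrite -preimage_bigcup -[X in measurable X]setTI;
    exact: measurable_cons_pair.
Qed.

HB.instance Definition _ := isMeasure.Build _ _ _ leb_step
  leb_step0 leb_step_ge0 leb_step_sigma_additive.

Let uncons (t : n.+1.-tuple (measurableTypeR R)) :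
    measurableTypeR R * n.-tuple (measurableTypeR R) :=
  (thead t, [tuple of behead t]).

Let measurable_uncons : measurable_fun setT uncons.
Proof.
apply: measurable_fun_pair; last exact: measurable_behead.
exact: measurable_tnth.
Qed.

Let leb_step_sigma_finite : sigma_finite setT leb_step.
Proof.
have /sigma_finiteP[F [TF ndF Foo]] := sigma_finiteT (@lebesgue_measure R).
have /sigma_finiteP[G [TG ndG Goo]] := sigma_finiteT mu.
exists (fun i => uncons @^-1` (F i `*` G i)).
  apply/esym/seteqP; split=> // t _.
  have [i _ Fi] : (\bigcup_i F i) (thead t) by rewrite -TF.
  have [j _ Gj] : (\bigcup_i G i) [tuple of behead t] by rewrite -TG.
  exists (maxn i j) => //; split => /=.
  - by move: (thead t) Fi; exact/subsetPset/ndF/leq_maxl.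
  - by move: Gj; apply/subsetPset/ndG/leq_maxr.
move=> i; have [mF Fi] := Foo i; have [mG Gi] := Goo i; split.
  rewrite -[X in measurable X]setTI.
  by apply: measurable_uncons => //; exact: measurableX.
rewrite /= /leb_step /pushforward (_ : _ @^-1` _ = F i `*` G i).
  by rewrite product_measure1E// lte_mul_pinfty// ge0_fin_numE.
apply/seteqP; split => -[a t] /=; rewrite /uncons /cons_pair/= theadE;
  suff -> : [tuple of behead [the n.+1.-tuple _ of a :: t]] = t by [].
- exact: val_inj.
- exact: val_inj.
Qed.

HB.instance Definition _ := Measure_isSigmaFinite.Build _ _ _ leb_step
  leb_step_sigma_finite.

End step.

(* Lebesgue measure on R^n: iterated product of the one-dimensional one,
   transported to tuples *)
Fixpoint lebesgue_tuple (n : nat) :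
    {sigma_finite_measure set (n.-tuple (measurableTypeR R)) -> \bar R} :=
  if n is m.+1 then leb_step (lebesgue_tuple m) else dirac [tuple].

End lebesgue_tuple.

Section matrices.
Variable R : realType.

(* [is_trig_mx] means lower triangular, so upper triangularity of T below is
   expressed through T^T *)
Definition is_cholesky n (L M : 'M[R]_n) : Prop :=
  [/\ is_trig_mx L, forall i, 0 < L i i & L *m L^T = M].

Definition is_thin_qr m n (Q : 'M[R]_(m, n)) (T : 'M[R]_n) (M : 'M[R]_(m, n)) :
    Prop :=
  [/\ Q^T *m Q = 1%:M, is_trig_mx T^T & Q *m T = M].

Definition tensor (a b c : nat) : Type := 'I_a -> 'I_b -> 'I_c -> R.

Lemma unfold_mod_subproof m n (j : 'I_(m * n)) : (j %% m < m)%N.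
Proof. by case: m j => [[]//|m] j; rewrite ltn_mod. Qed.

Lemma unfold_div_subproof m n (j : 'I_(m * n)) : (j %/ m < n)%N.
Proof.
by case: m j => [[]//|m] j; rewrite ltn_divLR// [X in (_ < X)%N]mulnC.
Qed.

(* column j = t + l * m holds the entries C a t l, with t and l counted from 0 *)
Definition unfold1 a m n (C : tensor a m n) : 'M[R]_(a, m * n) :=
  \matrix_(i, j) C i (Ordinal (unfold_mod_subproof j))
                     (Ordinal (unfold_div_subproof j)).

Definition tensor_mul_mid a m n (B : tensor a m n) (L : 'M[R]_m) :
    tensor a m n :=
  fun i t l => \sum_(j < m) B i j l * L j t.

(* the last index is summed against the column index of T *)
Definition tensor_mul_last a m n (A : tensor a m n) (T : 'M[R]_n) :
    tensor a m n :=
  fun i j l => \sum_(k < n) A i j k * T l k.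

End matrices.

(** Families indexed by nat use the indices 1..d (0..d for the ranks); their
    other values are unconstrained and irrelevant. Likewise all functions on
    X_k are total functions on R of which only the values on X_k matter. *)

Record squared_tt (R : realType) (d : nat) := SquaredTT {
  tt_d_gt0 : (0 < d)%N ;
  dom : nat -> set R ;
  weight : nat -> R -> R ;
  nbasis : nat -> nat ;
  basis : forall k, 'I_(nbasis k) -> R -> R ;
  rank : nat -> nat ;
  coeff : forall k, tensor R (rank k.-1) (nbasis k) (rank k) ;
  gamma : R ;
  dom_measurable : forall k, (1 <= k <= d)%N ->
    measurable (dom k : set (measurableTypeR R)) ;
  weight_measurable : forall k, (1 <= k <= d)%N ->
    measurable_fun (dom k : set (measurableTypeR R)) (weight k) ;
  weight_ge0 : forall k, (1 <= k <= d)%N ->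
    forall t, dom k t -> 0 <= weight k t ;
  weight_finite : forall k, (1 <= k <= d)%N ->
    (\int[lebesgue_measure]_(t in dom k) (weight k t)%:E < +oo)%E ;
  basis_measurable : forall k, (1 <= k <= d)%N -> forall i,
    measurable_fun (dom k : set (measurableTypeR R)) (@basis k i) ;
  basis_square_integrable : forall k, (1 <= k <= d)%N -> forall i,
    (\int[lebesgue_measure]_(t in dom k)
       (@basis k i t ^+ 2 * weight k t)%:E < +oo)%E ;
  (* linear independence in L^2 of the measure with density [weight k] *)
  basis_independent : forall k, (1 <= k <= d)%N ->
    forall c : 'I_(nbasis k) -> R,
    {ae (@lebesgue_measure R), forall t, dom k t -> 0 < weight k t ->
       \sum_i c i * @basis k i t = 0} ->
    forall i, c i = 0 ;
  rank_first : rank 0 = 1%N ;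
  rank_last : rank d = 1%N ;
  rank_bound : forall k, (1 <= k <= d)%N ->
    (rank k.-1 <= nbasis k * rank k)%N ;
  gamma_gt0 : 0 < gamma
}.

Arguments basis {R d} s k i t.
Arguments coeff {R d} s k.

Section squared_tt.
Variables (R : realType) (d : nat) (TT : squared_tt R d).
Local Notation X := (dom TT).
Local Notation lam := (weight TT).
Local Notation n := (nbasis TT).
Local Notation phi := (basis TT _).
Local Notation r := (rank TT).
Local Notation A := (coeff TT).

Definition total_weight k : R := \int[lebesgue_measure]_(t in X k) lam k t.

Definition mass_mx k : 'M[R]_(n k) :=
  \matrix_(i, j) \int[lebesgue_measure]_(t in X k)
                   (phi i t * phi j t * lam k t).

Definition tt_tensor k : Type := tensor R (r k.-1) (n k) (r k).

Definition core_mx k (B : tt_tensor k) (t : R) : 'M[R]_(r k.-1, r k) :=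
  \matrix_(a, l) \sum_(i < n k) phi i t * B a i l.

(* A point (x_1, ..., x_m) is a sequence of length m; k is counted from 1. *)
Definition xcoord (x : seq R) (k : nat) : R := nth 0 x k.-1.

(* The product of the first k cores, which reads only x_1, ..., x_k *)
Fixpoint tt_prefix (k : nat) (x : seq R) : 'M[R]_(r 0, r k) :=
  if k is j.+1 then tt_prefix j x *m core_mx (A j.+1) (xcoord x j.+1) else 1%:M.

Definition first_idx : 'I_(r 0) := cast_ord (esym (rank_first TT)) ord0.
Definition last_idx : 'I_(r d) := cast_ord (esym (rank_last TT)) ord0.

Definition G_lt (k : nat) (x : seq R) : 'rV[R]_(r k.-1) :=
  row first_idx (tt_prefix k.-1 x).

Definition gtilde (x : seq R) : R := tt_prefix d x first_idx last_idx.

Definition pihat (x : seq R) : R := gamma TT + gtilde x ^+ 2.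

(* The box X_{k+1} x ... x X_{k+m} *)
Definition box k m : set (m.-tuple (measurableTypeR R)) :=
  [set y | forall i : 'I_m, X (k + i.+1)%N (tnth y i)].
Arguments box k m y : clear implicits.

(* Extended-real valued, so that the equality in [defines_marginal] also asserts
   that the integral is finite *)
Definition pihat_le (k : nat) (x : seq R) : \bar R :=
  if k == d then (pihat x)%:E
  else (\int[lebesgue_tuple R (d - k)%N]_(y in box k (d - k)%N)
          (pihat (x ++ y) *
           \prod_(i < (d - k)%N) lam (k + i.+1)%N (tnth y i))%:E)%E.

Definition defines_marginal k (B : tt_tensor k) : Prop :=
  forall x : k.-tuple (measurableTypeR R), box 0%N k x ->
    pihat_le k x =
    (gamma TT * \prod_(k.+1 <= i < d.+1) total_weight i +
     \sum_(l < r k) (\sum_(a < r k.-1)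
        G_lt k x ord0 a * core_mx B (xcoord x k) a l) ^+ 2)%:E.

Definition unfolded k (B : tt_tensor k) (L : 'M[R]_(n k)) :
    'M[R]_(r k.-1, n k * r k) :=
  unfold1 (tensor_mul_mid B L).

Definition next_tensor k (T : 'M[R]_(r k.-1)) : tt_tensor k.-1 :=
  tensor_mul_last (A k.-1) T.

Inductive recursion_tensor : forall k, tt_tensor k -> Prop :=
| recursion_last : recursion_tensor (A d)
| recursion_step k (B : tt_tensor k) (L : 'M[R]_(n k))
    (Q : 'M[R]_(n k * r k, r k.-1)) (T : 'M[R]_(r k.-1)) :
    (1 < k <= d)%N -> recursion_tensor B ->
    is_cholesky L (mass_mx k) -> is_thin_qr Q T (unfolded B L)^T ->
    recursion_tensor (next_tensor T).

Definition zhat : \bar R :=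
  (\int[lebesgue_measure]_(t in X 1%N) (pihat_le 1 [:: t] * (lam 1 t)%:E))%E.

End squared_tt.

(* Main.v *)
(** By Tonelli, the marginal function of x_{<k} is the integral over x_k of the
    marginal function of x_{<=k}. Inserting the representation given by B_k, with
    v the row vector G_{<k}(x_{<k}), the integral of the sum of squares is a sum
    over l of quadratic forms w_l M_k w_l^T, where w_l = v B_k[., ., l]. Since
    M_k = L_k L_k^T, it equals |v C_k^(R)|^2, and C_k^(R) (C_k^(R))^T = R_k^T R_k
    turns this into |v R_k^T|^2; finally v = G_{<k-1} G_{k-1} is absorbed into
    B_{k-1}. For k = 1 one has v = 1, which gives the normalising constant. *)

Require Import Defs.
From mathcomp Require Import all_boot all_order all_algebra.
From mathcomp Require Import all_classical all_reals all_analysis.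
From mathcomp Require Import measurable_realfun ring lra.

Import Order.TTheory GRing.Theory Num.Theory.
Import numFieldNormedType.Exports.

Local Open Scope classical_set_scope.
Local Open Scope ring_scope.

(** * Sums over unfolded indices, Gram matrices of thin QR factors *)

Section linear_algebra.
Context {R : realType}.

(** By Euclidean division, [j] is determined by its remainder and quotient modulo [m]; equal
    cardinalities turn this injection into a bijection. *)
Lemma sum_unfold m n (F : 'I_m -> 'I_n -> R) :
  \sum_(j < m * n) F (Ordinal (unfold_mod_subproof j))
                     (Ordinal (unfold_div_subproof j)) =
  \sum_t \sum_l F t l.
Proof.
pose h (j : 'I_(m * n)) := (Ordinal (unfold_mod_subproof j),
                            Ordinal (unfold_div_subproof j)).
have h_bij : bijective h.
  apply: inj_card_bij => [i j [ijm ijd]|]; last by rewrite card_prod !card_ord.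
  by apply: val_inj; rewrite /= (divn_eq i m) (divn_eq j m) ijm ijd.
by rewrite pair_big [RHS](reindex h)//; exact: onW_bij.
Qed.

Lemma mulmx_tr_row n (v : 'rV[R]_n) :
  (v *m v^T) ord0 ord0 = \sum_j v ord0 j ^+ 2.
Proof. by rewrite mxE; apply: eq_bigr => j _; rewrite mxE expr2. Qed.

(** Orthonormal columns make $Q$ cancel: $CC^\top=(QT)^\top QT=T^\top T$. *)
Lemma thin_qr_gram m n (Q : 'M[R]_(m, n)) (T : 'M[R]_n) (C : 'M[R]_(n, m)) :
  is_thin_qr Q T C^T -> T^T *m T = C *m C^T.
Proof.
move=> [QQ _ /[dup] QT <-]; rewrite -[C in RHS]trmxK -QT trmx_mul.
by rewrite -mulmxA [Q^T *m _]mulmxA QQ mul1mx.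
Qed.

(** The rank $r_0$ equals 1 only propositionally, so the scalar $\mathsf R_1$ has to be read off
    through a cast. *)
Lemma castmx11E n (n1 : n = 1%N) (T : 'M[R]_n) i j :
  castmx (n1, n1) T ord0 ord0 = T i j.
Proof. by subst n; rewrite castmx_id !ord1. Qed.

End linear_algebra.

(** * Tonelli's theorem for Lebesgue measure on tuples *)

Lemma integral_lebesgue_tupleS (R : realType) n (D1 : set (measurableTypeR R))
    (D2 : set (n.-tuple (measurableTypeR R)))
    (D : set (n.+1.-tuple (measurableTypeR R))) (f : n.+1.-tuple _ -> \bar R) :
  measurable D1 -> measurable D2 -> measurable D ->
  @cons_pair R n @^-1` D = D1 `*` D2 ->
  measurable_fun D f -> (forall y, D y -> 0 <= f y)%E ->
  (\int[lebesgue_tuple R n.+1]_(y in D) f y =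
   \int[lebesgue_measure]_(t in D1)
     \int[lebesgue_tuple R n]_(y in D2) f (cons_pair (t, y)))%E.
Proof.
move=> mD1 mD2 mD DE mf f0.
have mcons := @measurable_cons_pair R n.
have mD12 : measurable (D1 `*` D2) by exact: measurableX.
have f0' z : (D1 `*` D2) z -> (0 <= f (cons_pair z))%E.
  by rewrite -DE => Dz; exact: f0.
(* [lebesgue_tuple R n.+1] is by construction the pushforward of the product measure under
   [cons_pair], so this is a change of variables. *)
transitivity (\int[lebesgue_measure \x lebesgue_tuple R n]_(z in D1 `*` D2)
    f (cons_pair z))%E.
  rewrite -DE -(ge0_integral_pushforward mcons)// => y.
  by rewrite inE => Dy; exact: f0.
(* Tonelli is applied on the whole product space: the integrand is extended by 0 outside [D1] times
   [D2], and the extension is undone slice by slice. *)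
rewrite integral_mkcond fubini_tonelli1.
- rewrite [RHS]integral_mkcond; apply: eq_integral => t _.
  rewrite /fubini_F [RHS]patchE; case: ifPn => [tD1|tD1].
    rewrite [RHS]integral_mkcond; apply: eq_integral => y _.
    rewrite !patchE; congr (if _ then _ else _).
    apply/idP/idP; rewrite !inE; first by case.
    by move=> yD2; split=> //; exact: set_mem tD1.
  rewrite integral0_eq// => y _; rewrite patchE ifF//; apply/negbTE.
  by apply: contra tD1; rewrite !inE => -[].
- apply: (iffLR (measurable_restrictT (f \o @cons_pair R n) mD12)).
  apply: (measurable_comp mD _ mf (measurable_funTS mcons)).
  by move=> y [z]; rewrite -DE => Dz <-.
- by move=> z; rewrite patchE; case: ifP => // /set_mem /f0'.
Qed.

(** * Algebra of the cores and the QR identity *)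

Section tensor_train.
Context {R : realType} {d : nat} {TT : squared_tt R d}.
Local Notation X := (dom TT).
Local Notation lam := (weight TT).
Local Notation phi := (Defs.basis TT _).
Local Notation r := (rank TT).
Local Notation box k m := (@Defs.box R d TT k m).

(** The row vector $w_l=v\,B[\cdot,\cdot,l]$: the coefficients of entry $l$ of $v$ times the core,
    in the basis of the $k$-th coordinate. *)
Definition core_coef k (B : tt_tensor TT k) (v : 'rV[R]_(r k.-1)) l :
    'rV[R]_(nbasis TT k) :=
  \row_i \sum_a v ord0 a * B a i l.

Lemma mul_core_mxE k (B : tt_tensor TT k) v t l :
  (v *m core_mx B t) ord0 l = \sum_i core_coef k B v l ord0 i * phi i t.
Proof.
rewrite mxE; under eq_bigr do rewrite mxE mulr_sumr.
rewrite exchange_big; apply: eq_bigr => i _; rewrite mxE mulr_suml.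
by apply: eq_bigr => a _; rewrite mulrCA mulrC.
Qed.

(** Summing $\mathsf A_{k-1}$ against the column index of $T$ multiplies the core on the right by
    $T^\top$; this absorbs $\mathsf R_k$ into $\mathsf B_{k-1}$. *)
Lemma mul_next_tensor k (T : 'M[R]_(r k.-1)) (u : 'rV_(r k.-1.-1)) t :
  u *m core_mx (next_tensor T) t =
  u *m core_mx (coeff TT k.-1) t *m T^T.
Proof.
rewrite -mulmxA; congr (_ *m _); apply/matrixP => a l; rewrite !mxE.
under eq_bigr do rewrite mulr_sumr.
rewrite exchange_big; apply: eq_bigr => b _; rewrite !mxE mulr_suml.
by apply: eq_bigr => i _; rewrite mulrA.
Qed.

(** Both sides equal $|vC^{(\rm R)}|^2$: the left by the Gram identity, the right by the Cholesky
    factorisation $M=LL^\top$. *)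
Lemma qr_sum_sqr k (B : tt_tensor TT k) (L : 'M[R]_(nbasis TT k))
    (Q : 'M[R]_(nbasis TT k * r k, r k.-1)) (T : 'M[R]_(r k.-1))
    (v : 'rV[R]_(r k.-1)) :
  is_cholesky L (mass_mx TT k) -> is_thin_qr Q T (unfolded B L)^T ->
  \sum_l (v *m T^T) ord0 l ^+ 2 =
  \sum_l (core_coef k B v l *m mass_mx TT k *m (core_coef k B v l)^T) ord0 ord0.
Proof.
move=> [_ _ <-] /thin_qr_gram TC.
rewrite -mulmx_tr_row trmx_mul trmxK mulmxA -[v *m _ *m _]mulmxA TC.
rewrite mulmxA -mulmxA -trmx_mul mulmx_tr_row.
pose F t l := (core_coef k B v l *m L) ord0 t ^+ 2.
(* Entry $j$ of $vC^{(\rm R)}$ is entry $t$ of $w_lL$, with $t$ the remainder and $l$ the quotient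
   of $j$. *)
transitivity (\sum_t \sum_l F t l).
  rewrite -sum_unfold; apply: eq_bigr => j _; congr (_ ^+ 2); rewrite !mxE.
  under eq_bigr do rewrite mxE mulr_sumr.
  rewrite exchange_big; apply: eq_bigr => i _; rewrite mxE mulr_suml.
  by apply: eq_bigr => a _; rewrite mulrA.
rewrite exchange_big; apply: eq_bigr => l _.
by rewrite mulmxA -mulmxA -trmx_mul mulmx_tr_row.
Qed.

(** * Dependence of the left partial products on the coordinates *)

Lemma G_ltS k (x : seq R) : (0 < k)%N ->
  G_lt TT k.+1 x = G_lt TT k x *m core_mx (coeff TT k) (xcoord x k).
Proof. by case: k => // k _; rewrite /G_lt /= row_mul. Qed.

Lemma xcoord_rcons (x : seq R) t : xcoord (rcons x t) (size x).+1 = t.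
Proof. by rewrite /xcoord /= nth_rcons ltnn eqxx. Qed.

Lemma tt_prefix_rcons j (x : seq R) t : (j <= size x)%N ->
  tt_prefix TT j (rcons x t) = tt_prefix TT j x.
Proof.
elim: j => //= j IH jx; rewrite IH ?(ltnW jx)//.
by rewrite /xcoord /= nth_rcons jx.
Qed.

(** $\mathsf G_{<k}$ reads only $x_{<k}$, so it stays fixed while $x_k$ is integrated. *)
Lemma G_lt_rcons (x : seq R) t :
  G_lt TT (size x).+1 (rcons x t) = G_lt TT (size x).+1 x.
Proof. by rewrite /G_lt /= tt_prefix_rcons. Qed.

(** * Integrals over a single coordinate *)

Lemma total_weightE k : (1 <= k <= d)%N ->
  (\int[lebesgue_measure]_(t in X k) (lam k t)%:E)%E = (total_weight TT k)%:E.
Proof.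
move=> kd; rewrite /total_weight /Rintegral fineK// ge0_fin_numE ?weight_finite//.
by apply: integral_ge0 => t /weight_ge0; rewrite lee_fin; exact.
Qed.

Lemma total_weight_ge0 k : (1 <= k <= d)%N -> 0 <= total_weight TT k.
Proof. by move=> kd; apply: Rintegral_ge0 => t /weight_ge0; exact. Qed.

Lemma measurable_basis_mul k (i j : 'I_(nbasis TT k)) : (1 <= k <= d)%N ->
  measurable_fun (X k : set (measurableTypeR R))
    (fun t => phi i t * phi j t * lam k t).
Proof.
move=> kd; apply: measurable_funM; last exact: weight_measurable.
by apply: measurable_funM; exact: basis_measurable.
Qed.

(** Domination by the square-integrable case, through $|ab|\le a^2+b^2$. *)
Lemma integrable_basis_mul k (i j : 'I_(nbasis TT k)) : (1 <= k <= d)%N ->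
  (@lebesgue_measure R).-integrable (X k)
    (EFin \o (fun t => phi i t * phi j t * lam k t)).
Proof.
move=> kd.
have mX := dom_measurable TT kd.
have sqr_integrable (h : 'I_(nbasis TT k)) :
    (@lebesgue_measure R).-integrable (X k)
      (EFin \o (fun t => phi h t ^+ 2 * lam k t)).
  apply/integrableP; split.
    by apply/measurable_EFinP; exact: (measurable_basis_mul _ h h).
  apply: le_lt_trans (basis_square_integrable kd h).
  rewrite le_eqVlt; apply/predU1l; apply: eq_integral.
  move=> t /set_mem Xt /=; rewrite ger0_norm// mulr_ge0 ?sqr_ge0//.
  exact: weight_ge0 Xt.
apply: (@le_integrable _ _ _ _ _ mX _
  (fun t => ((phi i t ^+ 2 + phi j t ^+ 2) * lam k t)%:E)).
- by apply/measurable_EFinP; exact: measurable_basis_mul.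
- move=> t /=; rewrite lee_fin normrM [leRHS]normrM ler_wpM2r//.
  rewrite [leRHS]ger0_norm ?addr_ge0 ?sqr_ge0// ler_norml; apply/andP; split; nra.
- apply: eq_integrable (integrableD mX (sqr_integrable i) (sqr_integrable j)) => //.
  by move=> t _ /=; rewrite mulrDl EFinD.
Qed.

(** The square expands into a double sum of terms of arbitrary sign; integrability of each product
    of basis functions permits termwise integration, which yields the mass matrix. *)
Lemma integral_core_sqr k (c : 'rV[R]_(nbasis TT k)) : (1 <= k <= d)%N ->
  (\int[lebesgue_measure]_(t in X k)
     ((\sum_i c ord0 i * phi i t) ^+ 2 * lam k t)%:E)%E =
  ((c *m mass_mx TT k *m c^T) ord0 ord0)%:E.
Proof.
move=> kd.
have mX := dom_measurable TT kd.
pose M (i j : 'I_(nbasis TT k)) t := (phi i t * phi j t * lam k t)%:E.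
have iM i j := integrable_basis_mul k i j kd.
have intM i j :
    (\int[lebesgue_measure]_(t in X k) M i j t = (mass_mx TT k i j)%:E)%E.
  by rewrite mxE /Rintegral fineK// (integrable_fin_num mX (iM i j)).
transitivity (\int[lebesgue_measure]_(t in X k)
    \sum_i \sum_j ((c ord0 i * c ord0 j)%:E * M i j t))%E.
  apply: eq_integral => t _; rewrite expr2 !mulr_suml -sumEFin.
  apply: eq_bigr => i _; rewrite mulr_sumr mulr_suml -sumEFin.
  apply: eq_bigr => j _; rewrite /M -EFinM; congr _%:E; ring.
rewrite integral_sum//; last first.
  by move=> i; apply: integrable_sum => // j _; exact: integrableZl (iM i j).
rewrite -mulmxA mxE -sumEFin; apply: eq_bigr => i _.
rewrite integral_sum//; last by move=> j; exact: integrableZl (iM i j).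
rewrite mxE mulr_sumr -sumEFin; apply: eq_bigr => j _.
rewrite (etrans (integralZl mX (iM i j) _) (congr1 _ (intM i j))) -EFinM.
by congr _%:E; rewrite !mxE -mulrA [_ * c _ j]mulrC.
Qed.

(** One integration step with $x_{<k}$ frozen: [v] stands for $\mathsf G_{<k}(x_{<k})$ and [c] for
    the constant term. With [c] nonnegative, every summand is nonnegative and the integral
    splits. *)
Lemma integral_marginal k (B : tt_tensor TT k) (L : 'M[R]_(nbasis TT k))
    (Q : 'M[R]_(nbasis TT k * r k, r k.-1)) (T : 'M[R]_(r k.-1))
    (v : 'rV[R]_(r k.-1)) (c : R) : (1 <= k <= d)%N -> 0 <= c ->
  is_cholesky L (mass_mx TT k) -> is_thin_qr Q T (unfolded B L)^T ->
  (\int[lebesgue_measure]_(t in X k)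
     ((c + \sum_l (v *m core_mx B t) ord0 l ^+ 2)%:E * (lam k t)%:E))%E =
  (c * total_weight TT k + \sum_l (v *m T^T) ord0 l ^+ 2)%:E.
Proof.
move=> kd c0 LM QT.
have mX := dom_measurable TT kd.
have mlam := @weight_measurable _ _ TT _ kd.
have lam0 := @weight_ge0 _ _ TT _ kd.
pose S l t := (\sum_i core_coef k B v l ord0 i * phi i t) ^+ 2 * lam k t.
have mS l : measurable_fun (X k : set (measurableTypeR R)) (S l).
  apply: measurable_funM => //; apply: measurable_funX; apply: measurable_sum => i.
  by apply: measurable_funM => //; exact: basis_measurable.
have S0 l t : X k t -> (0 <= (S l t)%:E)%E.
  by move=> Xt; rewrite lee_fin mulr_ge0 ?sqr_ge0 ?lam0.
transitivity (\int[lebesgue_measure]_(t in X k)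
    (c%:E * (lam k t)%:E + \sum_l (S l t)%:E))%E.
  apply: eq_integral => t _; rewrite sumEFin -!EFinM -EFinD mulrDl mulr_suml.
  by under eq_bigr do rewrite mul_core_mxE.
rewrite ge0_integralD//; first last.
- by apply: emeasurable_sum => l; exact/measurable_EFinP.
- by move=> t Xt; apply: sume_ge0 => l _; exact: S0.
- by apply: emeasurable_funM => //; exact/measurable_EFinP.
- by move=> t Xt; rewrite -EFinM lee_fin mulr_ge0 ?lam0.
rewrite ge0_integralZl//; last exact/measurable_EFinP.
rewrite total_weightE// -EFinM EFinD; congr (_ + _)%E.
rewrite ge0_integral_sum//; last by move=> l; exact/measurable_EFinP.
rewrite (qr_sum_sqr k B L Q)// -sumEFin; apply: eq_bigr => l _.
exact: integral_core_sqr.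
Qed.

(** * Boxes, and measurability of the integrand on them *)

Lemma measurable_box k m : (k + m <= d)%N -> measurable (box k m).
Proof.
move=> kmd.
rewrite (_ : box k m =
    \bigcap_(i in [set: 'I_m])
      [set y : m.-tuple (measurableTypeR R) | X (k + i.+1)%N (tnth y i)]).
  apply: fin_bigcap_measurable => // i _.
  rewrite -[X in measurable X]setTI; apply: measurable_tnth => //.
  apply: dom_measurable; rewrite addnS ltnS leq_addr /=.
  by rewrite (leq_trans _ kmd)// ltn_add2l.
by apply/seteqP; split=> [y yX i _|y yX i] /=; [exact: yX|exact: (yX i)].
Qed.

Lemma box_rcons k (x : k.-tuple (measurableTypeR R)) t :
  box 0 k x -> X k.+1 t -> box 0 k.+1 [tuple of rcons x t].
Proof.
move=> xX Xt i; rewrite (tnth_nth 0) /= nth_rcons size_tuple.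
have [ik|ki] := ltnP i k.
  by have := xX (Ordinal ik); rewrite (tnth_nth 0).
suff -> : nat_of_ord i = k by rewrite eqxx.
by apply/eqP; rewrite eqn_leq ki -ltnS ltn_ord.
Qed.

Lemma preimage_cons_box k m :
  @cons_pair R m @^-1` (box k m.+1) = X k.+1 `*` (box k.+1 m).
Proof.
apply/seteqP; split=> -[t y] /=.
  move=> tyX; split => [|i].
    by have := tyX ord0; rewrite addn1 (tnth_nth 0).
  by have := tyX (lift ord0 i); rewrite addSnnS !(tnth_nth 0).
move=> [/= Xt yX] i; case: (unliftP ord0 i) => [j ->|->].
  by have := yX j; rewrite addSnnS !(tnth_nth 0).
by rewrite addn1 (tnth_nth 0).
Qed.

(** Induction on the number of cores, with $x_{\le k}$ fixed. Measurability is claimed on the box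
    only, because the basis functions are controlled only on their domains. *)
Lemma measurable_tt_prefix k m j (x : seq R) a b : size x = k -> (k + m = d)%N ->
  (j <= d)%N ->
  measurable_fun (box k m) (fun y => tt_prefix TT j (x ++ y) a b).
Proof.
move=> xk kmd; elim: j a b => [|j IH] a b jd.
  by apply: measurable_cst.
rewrite [X in measurable_fun _ X](_ : _ = fun y : m.-tuple _ =>
  \sum_c tt_prefix TT j (x ++ y) a c *
    \sum_i phi i (xcoord (x ++ y) j.+1) * coeff TT j.+1 c i b); last first.
  by apply/funext => y /=; rewrite mxE; apply: eq_bigr => c _; rewrite mxE.
apply: measurable_sum => c; apply: measurable_funM.
  by apply: IH; exact: ltnW.
apply: measurable_sum => i; apply: measurable_funM => //.
(* Coordinate $j+1$ sits at position $j$ counted from 0: it is a constant taken from [x] if $j<k$,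
   and entry $j-k$ of [y] otherwise. *)
have [jk|kj] := ltnP j k.
  rewrite [X in measurable_fun _ X](_ : _ = cst (phi i (nth 0 x j)))//.
  by apply/funext => y /=; rewrite /xcoord /= nth_cat xk jk.
have jkm : (j - k < m)%N by rewrite ltn_subLR// kmd.
apply: (@measurable_comp _ _ _ _ _ _ (X j.+1 : set (measurableTypeR R)) (phi i) _
  (fun y : m.-tuple (measurableTypeR R) => xcoord (x ++ y) j.+1)).
- exact: dom_measurable.
- move=> _ [y yX <-]; have := yX (Ordinal jkm).
  by rewrite /xcoord /= nth_cat xk ltnNge kj /= addnS subnKC// (tnth_nth 0).
- exact: basis_measurable.
- rewrite [X in measurable_fun _ X](_ : _ =
      fun y : m.-tuple (measurableTypeR R) => tnth y (Ordinal jkm)).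
    by apply: measurable_funTS; exact: measurable_tnth.
  by apply/funext => y; rewrite /xcoord /= nth_cat xk ltnNge kj /= (tnth_nth 0).
Qed.

(** The number [m] of integrated coordinates is a free parameter instead of [d - k], so that peeling
    off one coordinate goes from [m.+1] to [m] without casts between tuple types. *)
Definition pihat_weighted k m (x : seq R) (y : m.-tuple (measurableTypeR R)) : R :=
  pihat TT (x ++ y) * \prod_(i < m) lam (k + i.+1)%N (tnth y i).

Lemma measurable_pihat_weighted k m (x : seq R) : size x = k -> (k + m = d)%N ->
  measurable_fun (box k m) (pihat_weighted k m x).
Proof.
move=> xk kmd; apply: measurable_funM.
  apply: measurable_funD => //; apply: measurable_funX.
  exact: measurable_tt_prefix.
apply: measurable_prod => i _.
have kid : (0 < k + i.+1 <= d)%N by rewrite addnS /= -kmd -addnS leq_add2l.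
apply: (@measurable_comp _ _ _ _ _ _ (X (k + i.+1)%N : set (measurableTypeR R))
  _ _ (fun y : m.-tuple (measurableTypeR R) => tnth y i)).
- exact: dom_measurable.
- by move=> _ [y yX <-]; exact: yX.
- exact: weight_measurable.
- by apply: measurable_funTS; exact: measurable_tnth.
Qed.

Lemma pihat_ge0 x : 0 <= pihat TT x.
Proof. by rewrite addr_ge0 ?sqr_ge0// (ltW (gamma_gt0 TT)). Qed.

Lemma pihat_weighted_ge0 k m x y : (k + m = d)%N -> box k m y ->
  0 <= pihat_weighted k m x y.
Proof.
move=> kmd yX; rewrite mulr_ge0 ?pihat_ge0// prodr_ge0// => i _.
apply: weight_ge0; last exact: yX.
by rewrite addnS /= -kmd -addnS leq_add2l.
Qed.

(** * Marginal functions as successive integrals *)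

Lemma pihat_le_last x : pihat_le TT d x = (pihat TT x)%:E.
Proof. by rewrite /pihat_le eqxx. Qed.

(* For [m = 0] the integral is against the Dirac mass at the empty tuple, which
   recovers the separate case [k = d] of [pihat_le]. *)
Lemma pihat_leE k m (x : seq R) : (k + m = d)%N ->
  (pihat_le TT k x =
   \int[lebesgue_tuple R m]_(y in box k m) (pihat_weighted k m x y)%:E)%E.
Proof.
move=> kmd; rewrite /pihat_le.
have [kd|kd] := eqVneq k d; last first.
  by have -> : (d - k)%N = m by rewrite -kmd addKn.
have m0 : m = 0%N by apply/eqP; rewrite -(eqn_add2l k) kmd kd addn0.
subst m.
have box0 : box k 0 = setT by apply/seteqP; split => // y _ [].
rewrite box0 /= integral_dirac//; last first.
  rewrite [X in measurable_fun _ X](_ : _ = cst (pihat_weighted k 0 x [tuple])%:E)//.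
  by apply/funext => y; rewrite tuple0.
by rewrite diracT mul1e /pihat_weighted big_ord0 mulr1 cats0.
Qed.

(** Tonelli, separating $x_{k+1}$ from the later coordinates. *)
Lemma pihat_leS k (x : seq R) : (k < d)%N -> size x = k ->
  (pihat_le TT k x =
   \int[lebesgue_measure]_(t in X k.+1)
     (pihat_le TT k.+1 (rcons x t) * (lam k.+1 t)%:E))%E.
Proof.
move=> kd xk; have [m kmd] : exists m, (k.+1 + m = d)%N.
  by exists (d - k.+1)%N; rewrite subnKC.
have kmSd : (k + m.+1 = d)%N by rewrite -addSnnS.
have mX : measurable (X k.+1 : set (measurableTypeR R)) by exact: dom_measurable.
have mbox : measurable (box k.+1 m) by apply: measurable_box; rewrite kmd.
rewrite (pihat_leE _ _ _ kmSd) (integral_lebesgue_tupleS _ _ _ _ _ _ mX mbox).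
- apply: eq_integral => t /set_mem Xt; rewrite (pihat_leE _ _ _ kmd).
  (* The weight of $x_{k+1}$ is constant in [y]; moved under the inner integral, it becomes the
     first factor of the weight product. *)
  rewrite -ge0_integralZr//; last first.
  + by rewrite lee_fin; apply: weight_ge0 Xt.
  + by move=> y yX; rewrite lee_fin pihat_weighted_ge0.
  + apply/measurable_EFinP; apply: measurable_pihat_weighted => //.
    by rewrite size_rcons xk.
  apply: eq_integral => y _; rewrite -EFinM /pihat_weighted; congr _%:E.
  rewrite big_ord_recl cat_rcons -mulrA; congr (_ * _).
  rewrite mulrC addn1; congr (_ * _).
  by apply: eq_bigr => i _; rewrite addSnnS !(tnth_nth 0).
- by apply: measurable_box; rewrite kmSd.
- exact: preimage_cons_box.
- by apply/measurable_EFinP; exact: measurable_pihat_weighted.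
- by move=> y yX; rewrite lee_fin pihat_weighted_ge0.
Qed.

(** * The recursion for the coefficient tensors *)

Lemma gamma_total_weight_ge0 k :
  0 <= gamma TT * \prod_(k.+1 <= i < d.+1) total_weight TT i.
Proof.
rewrite mulr_ge0 ?(ltW (gamma_gt0 TT))// big_seq prodr_ge0// => i.
rewrite mem_index_iota => /andP[ki id]; apply: total_weight_ge0.
by rewrite (leq_trans _ ki).
Qed.

(** Common source of the recursion step and of the normalising constant: the left side is
    $\hat\pi_{\le k}(x)$ for $k\ge1$, and $\hat z$ for $k=0$ with [x] empty. *)
Lemma integral_defines_marginal k (B : tt_tensor TT k.+1)
    (L : 'M[R]_(nbasis TT k.+1))
    (Q : 'M[R]_(nbasis TT k.+1 * r k.+1, r k)) (T : 'M[R]_(r k))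
    (x : k.-tuple (measurableTypeR R)) : (k < d)%N ->
  defines_marginal B -> is_cholesky L (mass_mx TT k.+1) ->
  is_thin_qr Q T (unfolded B L)^T -> box 0 k x ->
  (\int[lebesgue_measure]_(t in X k.+1)
     (pihat_le TT k.+1 (rcons x t) * (lam k.+1 t)%:E))%E =
  (gamma TT * \prod_(k.+1 <= i < d.+1) total_weight TT i +
   \sum_l (G_lt TT k.+1 x *m T^T) ord0 l ^+ 2)%:E.
Proof.
move=> kd Bdef LM QT xX.
(* The factor of index $k+1$ is split off: it is what integrating the constant term over $x_{k+1}$
   produces. *)
rewrite big_ltn// [total_weight _ _ * _]mulrC mulrA.
rewrite -(integral_marginal k.+1 B L Q T)//; last exact: gamma_total_weight_ge0.
apply: eq_integral => t /set_mem Xt.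
rewrite (Bdef [tuple of rcons x t] (box_rcons _ _ _ xX Xt)) /=.
congr (_%:E * _)%E; congr (_ + _); apply: eq_bigr => l _; congr (_ ^+ 2).
rewrite mxE; apply: eq_bigr => a _.
by have := G_lt_rcons x t; have := xcoord_rcons x t; rewrite size_tuple => -> ->.
Qed.

(** Since $r_d=1$, the sum over $\ell_d$ has the single term $\tilde g(x)^2$, and the product of
    weights is empty. *)
Lemma defines_marginal_last : defines_marginal (coeff TT d).
Proof.
move=> x _; rewrite pihat_le_last big_geq// mulr1 /pihat; congr (_ + _)%:E.
have d0 := tt_d_gt0 TT.
have -> : gtilde TT x = (G_lt TT d x *m core_mx (coeff TT d) (xcoord x d)) ord0
    (last_idx TT).
  by rewrite -G_ltS// mxE.
rewrite (bigD1 (last_idx TT))//= [X in _ + X]big_pred0 ?addr0.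
  by rewrite mxE.
move=> l; apply/negbTE; rewrite negbK; apply/eqP/val_inj.
suff all0 (i : 'I_(r d)) : i = 0%N :> nat by rewrite /= !all0.
by have := ltn_ord i; rewrite [X in (_ < X)%N](rank_last TT) ltnS leqn0 => /eqP.
Qed.

Lemma defines_marginal_step k (B : tt_tensor TT k) (L : 'M[R]_(nbasis TT k))
    (Q : 'M[R]_(nbasis TT k * r k, r k.-1)) (T : 'M[R]_(r k.-1)) :
  (1 < k <= d)%N -> defines_marginal B -> is_cholesky L (mass_mx TT k) ->
  is_thin_qr Q T (unfolded B L)^T -> defines_marginal (next_tensor T).
Proof.
(* Writing the index as a successor makes [k.-1] reduce, so that the types match. *)
case: k B L Q T => [//|k] B L Q T /andP[k0 kd] Bdef LM QT x xX.
rewrite pihat_leS ?size_tuple// (integral_defines_marginal k B L Q T)//.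
congr (_ + _)%:E; apply: eq_bigr => l _; congr (_ ^+ 2).
by rewrite G_ltS// -mul_next_tensor mxE.
Qed.

Lemma recursion_tensor_defines_marginal k (B : tt_tensor TT k) :
  recursion_tensor B -> defines_marginal B.
Proof.
elim=> [|{}k {}B L Q T kd _ Bdef LM QT]; first exact: defines_marginal_last.
exact: defines_marginal_step Bdef LM QT.
Qed.

End tensor_train.

Theorem proposition2 (R : realType) (d : nat) (TT : squared_tt R d) :
  [/\ (* (a) *)
      defines_marginal (coeff TT d) /\
      (forall x : seq R, pihat_le TT d x = (pihat TT x)%:E),
      (* (b) *)
      forall (k : nat) (B : tt_tensor TT k) (L : 'M[R]_(nbasis TT k))
        (Q : 'M[R]_(nbasis TT k * rank TT k, rank TT k.-1))
        (T : 'M[R]_(rank TT k.-1)),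
        (1 < k <= d)%N ->
        defines_marginal B ->
        is_cholesky L (mass_mx TT k) ->
        is_thin_qr Q T (unfolded B L)^T ->
        defines_marginal (next_tensor T)
    & (* (c) *)
      forall (B : tt_tensor TT 1) (L : 'M[R]_(nbasis TT 1))
        (Q : 'M[R]_(nbasis TT 1 * rank TT 1, rank TT 0))
        (T : 'M[R]_(rank TT 0)),
        recursion_tensor B ->
        is_cholesky L (mass_mx TT 1) ->
        is_thin_qr Q T (unfolded B L)^T ->
        let C1 : 'rV[R]_(nbasis TT 1 * rank TT 1) :=
          castmx (rank_first TT, erefl) (unfolded B L) in
        let R1 : R := castmx (rank_first TT, rank_first TT) T ord0 ord0 in
        R1 ^+ 2 = \sum_j C1 ord0 j ^+ 2 /\
        zhat TT =
          (gamma TT * \prod_(1 <= i < d.+1) total_weight TT i + R1 ^+ 2)%:E].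
Proof.
split.
- by split; [exact: defines_marginal_last|exact: pihat_le_last].
- by move=> k B L Q T kd; exact: defines_marginal_step.
move=> B L Q T /recursion_tensor_defines_marginal Bdef LM QT C1 R1.
(* As $r_0=1$, [i0] is the only index, and sums over it collapse. *)
pose i0 : 'I_(rank TT 0) := first_idx TT.
have i0E i : i = i0.
  by apply: (can_inj (cast_ordK (rank_first TT))); rewrite !ord1.
have R1E : R1 = T i0 i0 by exact: castmx11E.
have sum_i0 (F : 'I_(rank TT 0) -> R) : \sum_i F i = F i0.
  by rewrite (bigD1 i0)//= big_pred0 ?addr0// => i; rewrite (i0E i) eqxx.
split.
  (* For a single row the Gram identity reads $\mathsf R_1^2=\|\mathsf C_1^{(\rm R)}\|^2$. *)
  have /matrixP/(_ i0 i0) := thin_qr_gram _ _ _ _ _ QT.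
  rewrite mxE sum_i0 [T^T _ _]mxE -expr2 -R1E => ->.
  rewrite mxE; apply: eq_bigr => j _; rewrite [X in _ * X]mxE -expr2 /C1 castmxE.
  by rewrite cast_ord_id [cast_ord _ _]i0E.
have d0 := tt_d_gt0 TT.
have box0 : box TT 0 ([tuple] : 0.-tuple (measurableTypeR R)) by case.
(* At $k=0$ the point is empty and $\mathsf G_{<1}=1$, so the remaining sum of squares is $\mathsf
   R_1^2$. *)
have := integral_defines_marginal 0 B L Q T [tuple] d0 Bdef LM QT box0.
rewrite /zhat /= => ->; congr (_ + _)%:E.
rewrite sum_i0 R1E; congr (_ ^+ 2).
by rewrite mxE sum_i0 !mxE eqxx mul1r.
Qed.
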